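(* Let $\mathbb{F}$ be a field, $\sigma$ an automorphism of $\mathbb{F}$ with $\sigma^2=1$ (possibly the identity), $\mathbb{F}_0=\{x\in\mathbb{F}:x^\sigma=x\}$, and let $V$ be a $d$-dimensional vector space over $\mathbb{F}$ with a form $\langle\cdot,\cdot\rangle$ satisfying (F1)--(F3). Denote $k=\dim_{\mathbb{F}_0}\mathbb{F}\in\{1,2\}$ (depending on whether or not $\sigma$ is trivial). Let $a,b\in\mathbb{F}_0$ and suppose $a^2\neq b$. Then there exists an $(a,b)$-equiangular system $\Phi$ of $n$ vectors in $V$ only if $n\le d+\frac{k}{2}(d^2-d)$. If equality holds, then $\Phi\Phi^\dagger=cI$ for some $c\in\mathbb{F}_0$, where $c=0$ if $a=0$. If equality holds in Case O or Case U, then $\Phi$ is an $(a,b,c)$-ETF.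
   Context: Form conditions on $\langle\cdot,\cdot\rangle\colon V\times V\to\mathbb{F}$: (F1) $\langle u,\cdot\rangle$ is linear for every $u\in V$; (F2) $\langle u,v\rangle=\langle v,u\rangle^\sigma$ for all $u,v\in V$; (F3) if $\langle u,v\rangle=0$ for every $v\in V$, then $u=0$. Case O: $\mathbb{F}=\mathbb{F}_q$ with $q$ odd and $\sigma=1$. Case U: $\mathbb{F}=\mathbb{F}_{q^2}$ is finite (possibly of even order) and $\alpha^\sigma=\alpha^q$. For a sequence $\Phi=\{\varphi_j\}_{j=1}^n$ in $V$, the frame operator $\Phi\Phi^\dagger\colon V\to V$ is $\Phi\Phi^\dagger v=\sum_{j=1}^n\langle\varphi_j,v\rangle\varphi_j$. $\Phi$ is an $(a,b)$-equiangular system ($a,b\in\mathbb{F}_0$) if (i) $\langle\varphi_j,\varphi_j\rangle=a$ for every $j$, and (ii) $\langle\varphi_i,\varphi_j\rangle\langle\varphi_j,\varphi_i\rangle=b$ for all $i\neq j$. It is an $(a,b,c)$-equiangular tight frame, or $(a,b,c)$-ETF ($c\in\mathbb{F}_0$), if in addition (iii) $\operatorname{span}\Phi=V$ and (iv) $\Phi\Phi^\dagger=cI$.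
   Formalization: The bound is stated for d > 0; ''c = 0 if a = 0'' excludes the case of characteristic 2, trivial σ and d = 2; the final (a,b,c)-ETF claim excludes d = 1 with a = 0. The printed claims fail in these degenerate cases. *)

(* Defs.v *)
From HB Require Import structures.
From mathcomp Require Import all_boot all_order all_algebra.
From mathcomp Require Import ring.

Set Implicit Arguments.
Unset Strict Implicit.
Unset Printing Implicit Defensive.

Import GRing.Theory.
Local Open Scope ring_scope.

Section FixedField.
Variables (F : fieldType) (sigma : {rmorphism F -> F}).

Definition fixed_field : {pred F} := [pred x | sigma x == x].

(* F_0 is only a predicate on F, so that dim_{F_0} F = k is expressed by the
   existence of an F_0-basis of F with k elements. *)
Definition fixed_field_dim (k : nat) : Prop :=
  exists e : 'I_k -> F, forall x : F,
    exists! c : {ffun 'I_k -> F},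
      (forall i, c i \in fixed_field) /\ x = \sum_(i < k) c i * e i.

End FixedField.

Section Forms.
Variables (F : fieldType) (sigma : {rmorphism F -> F}) (V : vectType F).
Implicit Types (form : V -> V -> F) (a b c : F).

(* The forms of sesquilinear.v are linear in their first argument; these are
   linear in the second one. *)
Record nondeg_hermitian form : Prop := NondegHermitian {
  form_linear : forall u, scalar (form u);
  form_herm : forall u v, form u v = sigma (form v u);
  form_nondeg : forall u, (forall v, form u v = 0) -> u = 0
}.

Definition frame_operator form n (Phi : 'I_n -> V) (v : V) : V :=
  \sum_(j < n) form (Phi j) v *: Phi j.

Record equiangular_system form a b n (Phi : 'I_n -> V) : Prop :=
  EquiangularSystem {
    eqs_a_fixed : a \in fixed_field sigma;
    eqs_b_fixed : b \in fixed_field sigma;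
    eqs_norm : forall j, form (Phi j) (Phi j) = a;
    eqs_angle : forall i j, i != j ->
      form (Phi i) (Phi j) * form (Phi j) (Phi i) = b
  }.

Record equiangular_tight_frame form a b c n (Phi : 'I_n -> V) : Prop :=
  EquiangularTightFrame {
    etf_system : equiangular_system form a b Phi;
    etf_c_fixed : c \in fixed_field sigma;
    etf_span : <<[seq Phi j | j : 'I_n]>>%VS = fullv;
    etf_tight : forall v, frame_operator form Phi v = c *: v
  }.

End Forms.

Section Cases.
Variables (F : fieldType) (sigma : {rmorphism F -> F}).

Definition has_order (q : nat) : Prop := exists f : 'I_q -> F, bijective f.

Definition case_O : Prop := (exists2 q, odd q & has_order q) /\ sigma =1 id.

Definition case_U : Prop :=
  exists2 q, has_order (q ^ 2) & forall x, sigma x = x ^+ q.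

End Cases.

(* d + (k / 2) (d ^ 2 - d); the halving is exact since d ^ 2 - d is even. *)
Definition gerzon_bound (k d : nat) : nat := (d + (k * (d ^ 2 - d))./2)%N.

Lemma fixed_field_dimP (F : fieldType) (sigma : {rmorphism F -> F}) (k : nat) :
    involutive sigma ->
  fixed_field_dim sigma k <->
    (sigma =1 id /\ k = 1%N) \/ ((exists x, sigma x != x) /\ k = 2%N).
Proof.
move=> sK; split=> [[e eP]|]; last first.
  case=> [[s1 ->]|[[t st] ->]].
    exists (fun=> 1) => x; exists [ffun=> x]; split=> [|c [_ ->]].
      by split=> [i|]; rewrite ?inE ?s1 ?big_ord1 ?ffunE ?mulr1.
    by apply/ffunP=> i; rewrite ffunE big_ord1 mulr1 (ord1 i).
  have nz : t - sigma t != 0 by rewrite subr_eq0 eq_sym.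
  exists (fun i => if i == ord0 then 1 else t) => x.
  pose c1 := (x - sigma x) / (t - sigma t).
  have fc1 : sigma c1 = c1.
    by rewrite fmorph_div !rmorphB !sK -(opprB x) -(opprB t) divrNN.
  have sx : sigma x = x - c1 * (t - sigma t) by rewrite divfK // subKr.
  exists [ffun i : 'I_2 => if i == ord0 then x - c1 * t else c1].
  split=> [|c [fc xE]].
    rewrite big_ord_recl big_ord1 !ffunE /= mulr1 subrK; split=> // i.
    rewrite ffunE inE; case: ifP => _; last by rewrite fc1.
    by rewrite rmorphB rmorphM fc1 sx; apply/eqP; ring.
  have sc i : sigma (c i) = c i by apply/eqP/fc.
  move: xE; rewrite big_ord_recl big_ord1 /= mulr1 => xE.
  have c1E : c1 = c (lift ord0 ord0).
    apply: (mulIf nz); rewrite divfK // xE rmorphD rmorphM !sc; ring.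
  apply/ffunP=> i; rewrite ffunE; case: ifP => [/eqP ->|i0].
    by rewrite c1E xE addrK.
  rewrite c1E; congr (c _); apply/val_inj.
  by case: i i0 => [[|[|i]]].
have indep (c : 'I_k -> F) : (forall i, sigma (c i) = c i) ->
    \sum_(i < k) c i * e i = 0 -> forall i, c i = 0.
  move=> fc c0 i; have [c' [_ c'U]] := eP 0.
  have -> : c i = finfun c i by rewrite ffunE.
  rewrite -(c'U (finfun c)) ?(c'U [ffun=> 0]) ?ffunE //; split=> [j|].
  - by rewrite ffunE inE rmorph0.
  - by rewrite big1 // => j _; rewrite ffunE mul0r.
  - by rewrite ffunE inE fc.
  - by rewrite -[LHS]c0; apply: eq_bigr => j _; rewrite ffunE.
have gen x : exists2 c : 'I_k -> F,
    forall i, sigma (c i) = c i & x = \sum_(i < k) c i * e i.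
  by have [c [[fc ->] _]] := eP x; exists c => // i; apply/eqP/fc.
have kgt0 : (0 < k)%N.
  rewrite lt0n; apply/eqP=> k0; have [c _] := gen 1.
  rewrite big1 => [/eqP|i _]; first by rewrite oner_eq0.
  by have := leq_ltn_trans (leq0n i) (ltn_ord i); rewrite k0.
have rank_le r (A : 'M[F]_(k, r)) :
    (forall v : 'rV_k, v *m A = 0 -> v = 0) -> (k <= r)%N.
  move=> A0; apply: leq_trans (rank_leq_col A).
  suff /eqP -> : row_free A by [].
  by rewrite -kermx_eq0; apply/rowV0P=> v /sub_kermxP/A0.
have [/forallP/= se|/forallPn/= [j sej]] := boolP [forall i, sigma (e i) == e i].
  have s1 x : sigma x = x.
    have [c fc ->] := gen x; rewrite rmorph_sum.
    by apply: eq_bigr => i _; rewrite rmorphM fc (eqP (se i)).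
  left; split=> //; apply/eqP; rewrite eqn_leq kgt0 andbT.
  apply: (rank_le 1%N (\col_i e i)) => v /rowP/(_ ord0).
  rewrite !mxE => v0; apply/rowP=> i; rewrite mxE.
  apply: (indep (fun i => v 0 i)) => //.
  by rewrite -[RHS]v0; apply: eq_bigr => l _; rewrite mxE.
right; split; first by exists (e j).
apply/eqP; rewrite eqn_leq; apply/andP; split.
  apply: (rank_le 2%N (\matrix_(i, l) if l == ord0 then e i else sigma (e i))).
  move=> v /rowP v0; apply/rowP=> i; rewrite mxE; apply/eqP/negPn/negP=> vi.
  have v0e : \sum_l v 0 l * e l = 0.
    have := v0 ord0; rewrite !mxE => {2}<-.
    by apply: eq_bigr => l _; rewrite mxE.
  have v0s : \sum_l sigma (v 0 l) * e l = 0.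
    have /(congr1 sigma) := v0 (lift ord0 ord0).
    rewrite !mxE rmorph0 rmorph_sum => {2}<-.
    by apply: eq_bigr => l _; rewrite mxE rmorphM sK.
  have h s : s + sigma s = 0.
    have := indep (fun l => s / v 0 i * v 0 l + sigma (s / v 0 i * v 0 l)).
    move=> /(_ _ _ i); rewrite divfK //; apply=> [l|].
      by rewrite rmorphD sK addrC.
    under eq_bigr do rewrite rmorphM mulrDl -(mulrA (s / _)) -(mulrA (sigma _)).
    by rewrite big_split /= -!mulr_sumr v0e v0s !mulr0 addr0.
  have h1 := h 1; rewrite rmorph1 in h1.
  have hj : e j + e j = 0 by rewrite -{1 2}[e j]mul1r -mulrDl h1 mul0r.
  by case/eqP: sej; apply: (addrI (e j)); rewrite h hj.
rewrite ltn_neqAle kgt0 andbT; apply/eqP=> k1; subst k.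
have [c fc] := gen 1; have [c' fc'] := gen (e j).
rewrite !big_ord1 !(ord1 j) in sej * => _ ce.
have ce_nz : c ord0 != 0.
  by apply: contraTneq (oner_neq0 F) => c0; rewrite ce c0 mul0r eqxx.
case/eqP: sej; apply: (mulfI ce_nz).
by rewrite -ce -{1}(fc ord0) -rmorphM -ce rmorph1.
Qed.

(* Main.v *)
(* Represent the operators phi_j phi_j^† and the identity by the matrices Q_j
   and H of the forms (x, v) |-> <x, phi_j><phi_j, v> and (x, v) |-> <x, v>;
   they all lie in a space W of dimension at most D, the claimed bound.
   Evaluating at (phi_i, phi_i) turns Q_j into a^2 or b, according to whether
   i = j, and H into the constant a. Since a^2 <> b, any relation
   sum_j c_j Q_j = t H has all its c_j equal. Hence H together with all Q_j but
   one is free, so n <= D. If n = D, this family spans W; expanding the missing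
   Q_j yields a relation with all coefficients equal, i.e. sum_j Q_j = c H.
   When a = 0 <> c, evaluation and trace give n - 1 = 0 = d in F, which forces
   characteristic 2 and trivial sigma; then <phi_i, phi_j> is constant off the
   diagonal, so n - 1 <= d and d = 2. *)

Require Import Defs.
From HB Require Import structures.
From mathcomp Require Import all_boot all_order all_algebra.
From mathcomp Require Import ring zify.

Set Implicit Arguments.
Unset Strict Implicit.
Unset Printing Implicit Defensive.

Import GRing.Theory.
Local Open Scope ring_scope.

(** * Vectors separated by two-valued functionals *)

Section EquiangularFamily.
Variables (F : fieldType) (E : vectType F).

Lemma scalar_lincomb (f : E -> F) (fL : scalar f) (I : finType)
    (c : I -> F) (v : I -> E) :
  f (\sum_i c i *: v i) = \sum_i c i * f (v i).
Proof.
pose fM := GRing.isLinear.Build F E F *%R f fL.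
pose g : {scalar E} := HB.pack f fM.
by rewrite -[f]/(g : E -> F) linear_sum; apply: eq_bigr => i _; rewrite linearZ.
Qed.

(** Equation i rearranges to [c i * (p - r) = s - r * \sum_j c j], whose right side does not depend
    on i. *)
Lemma equal_coef (n : nat) (p r s : F) (c : 'I_n -> F) : p != r ->
    (forall i, \sum_j c j * (if i == j then p else r) = s) ->
  forall i j, c i = c j.
Proof.
move=> pr cs i j.
have csE l : c l * (p - r) = s - r * \sum_j c j.
  rewrite -(cs l) (bigD1 l) //= (bigD1 (F := c) l) //= eqxx mulrDr.
  rewrite (eq_bigr (fun j => r * c j)) => [|t /negPf tl].
    by rewrite -mulr_sumr; ring.
  by rewrite eq_sym tl mulrC.
by apply: (@mulIf _ (p - r)); rewrite ?subr_eq0 // !csE.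
Qed.

Variables (m : nat) (Q : 'I_m.+1 -> E) (tau : 'I_m.+1 -> E -> F).
Variables (p r s : F) (h : E).
Hypothesis tau_scalar : forall i, scalar (tau i).
Hypothesis tauQ : forall i j, tau i (Q j) = if i == j then p else r.
Hypothesis tauh : forall i, tau i h = s.
Hypothesis neq_pr : p != r.

Lemma lincomb_equal_coef (c : 'I_m.+1 -> F) (t : F) :
  \sum_j c j *: Q j = t *: h -> forall i j, c i = c j.
Proof.
move=> cQ; apply: (equal_coef (s := t * s) neq_pr) => i.
transitivity (tau i (\sum_j c j *: Q j)).
  by rewrite scalar_lincomb //; apply: eq_bigr => j _; rewrite tauQ.
have := scalar_lincomb (tau_scalar i) (fun _ : 'I_1 => t) (fun=> h).
by rewrite cQ !big_ord1 tauh.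
Qed.

Definition tail_family : m.-tuple E := [tuple Q (lift ord0 j) | j < m].

Lemma tail_lincomb (c : 'I_m -> F) :
  \sum_(j < m) c j *: tail_family`_j = \sum_(j < m) c j *: Q (lift ord0 j).
Proof. by apply: eq_bigr => j _; rewrite -tnth_nth tnth_mktuple. Qed.

(** A relation extends to all of [Q] with coefficient 0 at [ord0]; the coefficients of [Q] being
    equal, they vanish, and only the term in [h] is left. *)
Lemma free_cons_tail : h != 0 -> free (h :: tail_family).
Proof.
move=> h0; apply/(@freeP _ _ _ [tuple of h :: tail_family]) => k.
rewrite big_ord_recl /= tail_lincomb => kE.
pose c i := if unlift ord0 i is Some j then k (lift ord0 j) else 0.
have ck j : c (lift ord0 j) = k (lift ord0 j) by rewrite /c liftK.
have c0 : c ord0 = 0 by rewrite /c unlift_none.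
have cE : \sum_j c j *: Q j = - k ord0 *: h.
  rewrite big_ord_recl c0 scale0r add0r scaleNr; apply/eqP.
  rewrite -addr_eq0 addrC -[X in _ == X]kE; apply/eqP; congr (_ + _).
  by apply: eq_bigr => j _; rewrite ck.
have cz i : c i = 0 by rewrite (lincomb_equal_coef cE i ord0).
move=> i; case: (unliftP ord0 i) => [j|] ->; first by rewrite -ck cz.
move: cE; rewrite big1 => [/esym/eqP|j _]; last by rewrite cz scale0r.
by rewrite scaler_eq0 oppr_eq0 (negPf h0) orbF => /eqP.
Qed.

Lemma dim_cons_tail : h != 0 -> \dim <<h :: tail_family>> = m.+1.
Proof.
by move=> h0; apply/eqP; have := free_cons_tail h0; rewrite /free /= size_tuple card_ord.
Qed.

(** Covers [h = 0], the case applied later to the vectors [Phi j] themselves. *)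
Lemma free_tail : free tail_family.
Proof.
apply/freeP => k; rewrite tail_lincomb => kE.
pose c i := if unlift ord0 i is Some j then k j else 0.
have ck j : c (lift ord0 j) = k j by rewrite /c liftK.
have c0 : c ord0 = 0 by rewrite /c unlift_none.
have cE : \sum_j c j *: Q j = 0 *: h.
  rewrite big_ord_recl c0 !scale0r add0r -[RHS]kE.
  by apply: eq_bigr => j _; rewrite ck.
by move=> i; rewrite -ck (lincomb_equal_coef cE _ ord0).
Qed.

Lemma span_sub (W : {vspace E}) :
  h \in W -> (forall j, Q j \in W) -> (<<h :: tail_family>> <= W)%VS.
Proof.
move=> hW QW; apply/span_subvP => x; rewrite inE => /predU1P[->|]; first exact: hW.
case/tnthP => j ->; rewrite tnth_mktuple; exact: QW.
Qed.

Lemma equiangular_family_bound (W : {vspace E}) : h != 0 ->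
  h \in W -> (forall j, Q j \in W) -> (m < \dim W)%N.
Proof.
move=> h0 hW QW; have /dimvS := span_sub hW QW.
by rewrite dim_cons_tail.
Qed.

Lemma equiangular_family_span (W : {vspace E}) : h != 0 ->
  h \in W -> (forall j, Q j \in W) -> (\dim W <= m.+1)%N ->
  (W <= <<h :: tail_family>>)%VS.
Proof.
move=> h0 hW QW dW.
suff <- : <<h :: tail_family>>%VS = W by [].
apply/eqP; rewrite eqEdim span_sub //=.
by rewrite dim_cons_tail.
Qed.

Lemma equiangular_family_decomp (W : {vspace E}) : h != 0 ->
  h \in W -> (forall j, Q j \in W) -> (\dim W <= m.+1)%N ->
  forall x, x \in W -> exists (t : F) (k : 'I_m -> F),
    x = t *: h + \sum_(j < m) k j *: Q (lift ord0 j).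
Proof.
move=> h0 hW QW dW x xW.
have /subvP/(_ _ xW) := equiangular_family_span h0 hW QW dW.
move=> /(@coord_span _ _ _ [tuple of h :: tail_family]).
rewrite big_ord_recl /= tail_lincomb => xE.
by eexists _, _; exact: xE.
Qed.

Lemma equiangular_family_tight (W : {vspace E}) : h != 0 ->
  h \in W -> (forall j, Q j \in W) -> (\dim W <= m.+1)%N ->
  exists c, \sum_j Q j = c *: h.
Proof.
move=> h0 hW QW dW.
have [t [k Q0]] := equiangular_family_decomp h0 hW QW dW (QW ord0).
(* Moving the expansion of [Q ord0] to one side gives a relation with coefficient 1 at [ord0], hence
   1 everywhere. *)
pose c i := if unlift ord0 i is Some j then - k j else 1.
have c0 : c ord0 = 1 by rewrite /c unlift_none.
have cE : \sum_j c j *: Q j = t *: h.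
  rewrite big_ord_recl c0 scale1r {1}Q0 -addrA -big_split /= big1 ?addr0 // => j _.
  by rewrite /c liftK scaleNr subrr.
exists t; rewrite -cE; apply: eq_bigr => j _.
by rewrite (lincomb_equal_coef cE _ ord0) c0 scale1r.
Qed.

End EquiangularFamily.

(** * The bound and the space of symmetric matrices *)

Lemma gerzon_bound1 d : (2 * gerzon_bound 1 d = d * d.+1)%N.
Proof. by elim: d => [//|d]; rewrite /gerzon_bound; nia. Qed.

Lemma gerzon_bound2 d : (gerzon_bound 2 d = d * d)%N.
Proof. by rewrite /gerzon_bound mul2n doubleK; nia. Qed.

Section SymmetricMatrices.
Variables (F : fieldType) (d : nat).

(** The diagonal is treated apart because [delta_mx i i + delta_mx i i] vanishes in characteristic
    2. *)
Definition sym_delta (i j : 'I_d) : 'M[F]_d :=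
  if i == j then delta_mx i i else delta_mx i j + delta_mx j i.

Definition sym_space : {vspace 'M[F]_d} :=
  (\sum_(j < d) \sum_(i < d | (i <= j)%N) <[sym_delta i j]>)%VS.

Lemma dim_sym_space : (\dim sym_space <= gerzon_bound 1 d)%N.
Proof.
apply: leq_trans (dimv_leq_sum _ _ _) _.
have -> : gerzon_bound 1 d = (\sum_(j < d) j.+1)%N.
  elim: d => [|e IH]; first by rewrite big_ord0.
  by rewrite big_ord_recr /= -IH /gerzon_bound; nia.
apply: leq_sum => j _; apply: leq_trans; first exact: dimv_leq_sum.
apply: (@leq_trans (\sum_(i < d | (i < j.+1)%N) 1)%N).
  by apply: leq_sum => i _; rewrite dim_vline leq_b1.
by rewrite (big_ord_narrow (ltn_ord j)) sum1_card card_ord.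
Qed.

Lemma sym_deltaE (i j u v : 'I_d) :
  sym_delta i j u v = ((u == i) && (v == j) || (u == j) && (v == i))%:R.
Proof.
rewrite /sym_delta; have [->|ij] := eqVneq i j; first by rewrite mxE orbb.
rewrite !mxE; have [->|] := eqVneq u i; last by rewrite add0r.
by rewrite (negPf ij) orbF addr0.
Qed.

Lemma mem_sym_space (A : 'M[F]_d) : A^T = A -> A \in sym_space.
Proof.
move=> AT.
have -> : A = \sum_(j < d) \sum_(i < d | (i <= j)%N) A i j *: sym_delta i j.
  (* [A] and its expansion [B] are both symmetric, so it suffices to compare entries with [u <= v];
     there only the term [i = u], [j = v] survives. *)
  pose B := \sum_(j < d) \sum_(i < d | (i <= j)%N) A i j *: sym_delta i j.
  have BE u v : B u v = \sum_(j < d) \sum_(i < d | (i <= j)%N)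
      A i j * ((u == i) && (v == j) || (u == j) && (v == i))%:R.
    rewrite summxE; apply: eq_bigr => j _; rewrite summxE.
    by apply: eq_bigr => i _; rewrite mxE sym_deltaE.
  have Bsym u v : B u v = B v u.
    rewrite !BE; apply: eq_bigr => j _; apply: eq_bigr => i _.
    by rewrite orbC andbC [X in _ || X]andbC.
  have Ble (u v : 'I_d) : (u <= v)%N -> A u v = B u v.
    move=> uv; rewrite BE (bigD1 v) //= (bigD1 u) //= !eqxx mulr1.
    rewrite big1 => [|i /andP[_ /negPf iu]]; last first.
      rewrite [u == i]eq_sym iu; have [vi|] := eqVneq v i; last by rewrite andbF mulr0.
      by rewrite vi [u == i]eq_sym iu mulr0.
    rewrite addr0 big1 ?addr0 // => j /negPf jv; apply: big1 => i ij.
    rewrite [v == j]eq_sym jv andbF /=.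
    have [/= uj|] := eqVneq u j; last by rewrite mulr0.
    have [/= vi|] := eqVneq v i; last by rewrite mulr0.
    by case/negP: (negbT jv); apply/eqP/val_inj => /=; subst u v; lia.
  apply/matrixP => u v; have [/Ble//|/ltnW/Ble Avu] := leqP u v.
  by rewrite -/B Bsym -Avu -{1}AT mxE.
by apply: memv_sumr => j _; apply: memv_sumr => i _; rewrite memvZ ?memv_line.
Qed.

End SymmetricMatrices.

(** * Hermitian forms and their matrices *)

Section HermitianForm.
Variables (F : fieldType) (sigma : {rmorphism F -> F}) (V : vectType F).
Variable form : V -> V -> F.
Hypothesis form_ok : nondeg_hermitian sigma form.

Let d := \dim {:V}.
Let e (i : 'I_d) : V := (vbasis {:V})`_i.

Definition vcoord (v : V) (i : 'I_d) : F := coord (vbasis {:V}) i v.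

Lemma vcoordE v : v = \sum_i vcoord v i *: e i.
Proof. exact: coord_vbasis (memvf v). Qed.

Lemma form_lincombr u (I : finType) (c : I -> F) (v : I -> V) :
  form u (\sum_i c i *: v i) = \sum_i c i * form u (v i).
Proof. exact: scalar_lincomb (form_linear form_ok u) _ _ _. Qed.

Lemma form_lincombl (I : finType) (c : I -> F) (u : I -> V) v :
  form (\sum_i c i *: u i) v = \sum_i sigma (c i) * form (u i) v.
Proof.
rewrite (form_herm form_ok) form_lincombr rmorph_sum.
by apply: eq_bigr => i _; rewrite rmorphM -(form_herm form_ok).
Qed.

Lemma formDr u v w : form u (v + w) = form u v + form u w.
Proof. by have := form_linear form_ok u 1 v w; rewrite scale1r mul1r. Qed.

Lemma form0r u : form u 0 = 0.
Proof. by apply: (addrI (form u 0)); rewrite -formDr !addr0. Qed.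

Lemma formZr u c v : form u (c *: v) = c * form u v.
Proof. by have := form_linear form_ok u c v 0; rewrite !addr0 form0r addr0. Qed.

Lemma form_eq0C u v : form u v = 0 -> form v u = 0.
Proof. by rewrite (form_herm form_ok v) => ->; rewrite rmorph0. Qed.

Lemma form_neq0 u : u != 0 -> exists v, form u v != 0.
Proof.
(* Searching only the finite basis makes the existence of a witness a boolean test. *)
move=> u0; have [[i ui]|nz] := altP (@existsP _ (fun i => form u (e i) != 0)).
  by exists (e i).
case/eqP: u0; apply: (form_nondeg form_ok) => v.
rewrite (vcoordE v) form_lincombr big1 // => i _.
by move/existsPn/(_ i)/negPn/eqP: nz => ->; rewrite mulr0.
Qed.

Lemma form_inj u v : (forall x, form x u = form x v) -> u = v.
Proof.
move=> uv; apply/eqP; rewrite -subr_eq0; apply/eqP.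
apply: (form_nondeg form_ok) => x; apply: form_eq0C.
by rewrite formDr -scaleN1r formZr uv mulN1r subrr.
Qed.

(** The matrix of a form, not of the operator u u^†, so that it is symmetric when [sigma] is
    trivial. *)
Definition rank1_mx (u : V) : 'M[F]_d :=
  \matrix_(i, l) (form (e i) u * form u (e l)).

Definition gram_mx : 'M[F]_d := \matrix_(i, l) form (e i) (e l).

Definition sesq (M : 'M[F]_d) (x v : V) : F :=
  \sum_i \sum_l sigma (vcoord x i) * M i l * vcoord v l.

Lemma sesq_scalar x v : scalar (fun M => sesq M x v).
Proof.
move=> c M N; rewrite /sesq mulr_sumr -big_split; apply: eq_bigr => i _ /=.
rewrite mulr_sumr -big_split; apply: eq_bigr => l _ /=.
by rewrite !mxE; ring.
Qed.

Lemma sesq_lincomb (I : finType) (c : I -> F) (M : I -> 'M[F]_d) x v :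
  sesq (\sum_i c i *: M i) x v = \sum_i c i * sesq (M i) x v.
Proof. exact: scalar_lincomb (sesq_scalar x v) _ _ _. Qed.

Lemma sesqZ c M x v : sesq (c *: M) x v = c * sesq M x v.
Proof.
by have := sesq_lincomb (fun _ : 'I_1 => c) (fun=> M) x v; rewrite !big_ord1.
Qed.

Lemma sesq_rank1 u x v : sesq (rank1_mx u) x v = form x u * form u v.
Proof.
rewrite {2}(vcoordE x) {2}(vcoordE v) form_lincombl form_lincombr.
rewrite big_distrl; apply: eq_bigr => i _ /=.
rewrite big_distrr; apply: eq_bigr => l _ /=.
by rewrite mxE; ring.
Qed.

Lemma sesq_gram x v : sesq gram_mx x v = form x v.
Proof.
rewrite {2}(vcoordE x) {2}(vcoordE v) form_lincombl.
apply: eq_bigr => i _; rewrite form_lincombr big_distrr.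
by apply: eq_bigr => l _ /=; rewrite mxE; ring.
Qed.

Lemma gram_mx_neq0 : (0 < d)%N -> gram_mx != 0.
Proof.
move=> d0; apply/eqP => g0.
have : vpick {:V} != 0 by rewrite vpick0 -dimv_eq0 -lt0n.
case/form_neq0 => v /eqP[]; rewrite -sesq_gram g0 /sesq.
by apply: big1 => i _; apply: big1 => l _; rewrite mxE mulr0 mul0r.
Qed.

(* W can be a space over F rather than F_0: when sigma is nontrivial, the F-span
   of the Hermitian matrices is the space of all matrices, of dimension d ^ 2. *)
Lemma hermitian_space k :
    (sigma =1 id /\ k = 1%N) \/ ((exists x, sigma x != x) /\ k = 2%N) ->
  exists W : {vspace 'M[F]_d},
    [/\ (\dim W <= gerzon_bound k d)%N, gram_mx \in W
      & forall u, rank1_mx u \in W].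
Proof.
case=> [[s1 ->]|[_ ->]].
  have fC x y : form x y = form y x by rewrite (form_herm form_ok) s1.
  exists (sym_space F d); split=> [||u]; first exact: dim_sym_space.
    by apply: mem_sym_space; apply/matrixP => i l; rewrite !mxE fC.
  apply: mem_sym_space; apply/matrixP => i l; rewrite !mxE mulrC.
  by rewrite (fC u) (fC (e l)).
exists fullv; split=> [||u]; rewrite ?memvf // dimvf dim_matrix //.
by rewrite gerzon_bound2.
Qed.

(** Pairing with a basis of [U] maps V linearly to a space of smaller dimension; a nonzero kernel
    vector serves as w. *)
Lemma orthogonal_vector (U : {vspace V}) : U != fullv ->
  exists2 w, w != 0 & forall u, u \in U -> form u w = 0.
Proof.
move=> nU.
pose f (v : V) := \row_(i < \dim U) form (vbasis U)`_i v.
have gL : linear f.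
  by move=> c v w; apply/rowP => i; rewrite !mxE (form_linear form_ok).
pose gM := GRing.isLinear.Build F V _ _ f gL.
pose g : {linear V -> 'rV[F]_(\dim U)} := HB.pack f gM.
have kg : lker (linfun g) != 0%VS.
  have := limg_ker_dim (linfun g) fullv.
  have := dimvS (subvf (linfun g @: fullv)%VS).
  rewrite capfv dimvf /dim /= mul1n => le1 sumE.
  have ltU : (\dim U < \dim {:V})%N.
    by rewrite ltnNge; apply: contra nU => dU; rewrite eqEdim subvf.
  by rewrite -dimv_eq0 -lt0n; lia.
exists (vpick (lker (linfun g))); first by rewrite vpick0.
have := memv_pick (lker (linfun g)); rewrite memv_ker lfunE /= => /eqP/rowP w0.
move=> u uU; rewrite (coord_vbasis uU) form_lincombl big1 // => i _.
by have := w0 i; rewrite !mxE => ->; rewrite mulr0.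
Qed.


(** * Equiangular systems: bound, tightness, span *)

Section EquiangularSystem.
Variables (k m : nat) (a b : F) (Phi : 'I_m.+1 -> V).
Hypothesis kP :
  (sigma =1 id /\ k = 1%N) \/ ((exists x, sigma x != x) /\ k = 2%N).
Hypothesis neq_a2b : a ^+ 2 != b.
Hypothesis Phi_eqs : equiangular_system sigma form a b Phi.
Hypothesis d_gt0 : (0 < d)%N.

Let Q j := rank1_mx (Phi j).
Let tau i M := sesq M (Phi i) (Phi i).

Let tau_scalar i : scalar (tau i).
Proof. exact: sesq_scalar. Qed.

Let tauQ i j : tau i (Q j) = if i == j then a ^+ 2 else b.
Proof.
rewrite /tau sesq_rank1; have [->|ij] := eqVneq i j.
  by rewrite (eqs_norm Phi_eqs).
by rewrite (eqs_angle Phi_eqs).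
Qed.

Let tauh i : tau i gram_mx = a.
Proof. by rewrite /tau sesq_gram (eqs_norm Phi_eqs). Qed.

Lemma equiangular_system_bound : (m < gerzon_bound k d)%N.
Proof.
have [W [dW hW QW]] := hermitian_space kP.
apply: leq_trans dW.
exact: (equiangular_family_bound tau_scalar tauQ tauh neq_a2b
         (gram_mx_neq0 d_gt0) hW (fun j => QW (Phi j))).
Qed.

Hypothesis mE : m.+1 = gerzon_bound k d.

(** Evaluates [\sum_j Q j = c *: gram_mx] at (x, v); nondegeneracy later turns this into the
    operator identity. *)
Lemma equiangular_system_tight : exists c,
  forall x v, \sum_j form x (Phi j) * form (Phi j) v = c * form x v.
Proof.
have [W [dW hW QW]] := hermitian_space kP; rewrite -mE in dW.
have [c cE] := equiangular_family_tight tau_scalar tauQ tauh neq_a2b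
         (gram_mx_neq0 d_gt0) hW (fun j => QW (Phi j)) dW.
exists c => x v; rewrite -[in RHS]sesq_gram -sesqZ -cE.
under [in RHS]eq_bigr do rewrite -[Q _]scale1r.
by rewrite sesq_lincomb; apply: eq_bigr => j _; rewrite mul1r sesq_rank1.
Qed.

(** Provides a nonzero value to cancel when showing that [sigma] fixes c. *)
Lemma form_neq0_dual : exists x v, form x v != 0.
Proof.
have /form_neq0[v] : vpick {:V} != 0 by rewrite vpick0 -dimv_eq0 -lt0n.
by exists (vpick {:V}), v.
Qed.

(* If w is orthogonal to every Phi j, then all operators spanned by the identity
   and the phi_j phi_j^† send w into its own line, including u u^† for every
   vector u; this forces dimension 1. *)
Lemma equiangular_system_span : ~ (d = 1%N /\ a = 0) ->
  <<[seq Phi j | j : 'I_m.+1]>>%VS = fullv.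
Proof.
move=> nd; apply/eqP; apply/negPn/negP => /orthogonal_vector[w w0 wPhi].
have Phiw j : form (Phi j) w = 0 by apply: wPhi; rewrite memv_span ?image_f.
have [W [dW hW QW]] := hermitian_space kP; rewrite -mE in dW.
have decomp := equiangular_family_decomp tau_scalar tauQ tauh neq_a2b
         (gram_mx_neq0 d_gt0) hW (fun j => QW (Phi j)) dW.
(* Expand [rank1_mx u] in [gram_mx] and the [Q j]; applied to [w], each [Q j] dies and <u, w> u = t
   w remains. *)
have line u : form u w != 0 -> u \in <[w]>%VS.
  move=> uw; have [t [c cE]] := decomp _ (QW u).
  have uE : form u w *: u = t *: w.
    apply: form_inj => x; rewrite !formZr mulrC -sesq_rank1 cE addrC.
    rewrite addrC sesq_scalar sesq_gram sesq_lincomb big1 ?addr0 // => j _.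
    by rewrite sesq_rank1 Phiw !mulr0.
  by rewrite -[u](scalerK uw) uE !memvZ ?memv_line.
have [u wu] := form_neq0 w0.
have wC x : form w x != 0 -> x \in <[w]>%VS.
  by move=> wx; apply: line; apply: contra_neq wx; apply: form_eq0C.
(* If <w, x> = 0, then x + u and u both pair nontrivially with w, so their difference x lies in the
   line. *)
have full x : x \in <[w]>%VS.
  have [wx|/wC//] := eqVneq (form w x) 0.
  rewrite -[x](addrK u) memvB ?wC //.
  by rewrite formDr wx add0r.
(* This exception occurs: for d = 1 the single vector 0 has a = 0 and any b. *)
apply: nd; split.
  transitivity (\dim <[w]>); last by rewrite dim_vline w0.
  congr (\dim _).
  by apply/vspaceP => x; rewrite full memvf.
rewrite -(eqs_norm Phi_eqs ord0).
by have /vlineP[c {2}->] := full (Phi ord0); rewrite formZr Phiw mulr0.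
Qed.

(** Takes traces in Phi Phi^† = cI: each phi_j phi_j^† has trace <phi_j, phi_j> = a. *)
Lemma tight_constant_trace c :
    (forall x v, \sum_j form x (Phi j) * form (Phi j) v = c * form x v) ->
  d%:R * c = m.+1%:R * a.
Proof.
move=> cE.
have opE v : \sum_j form (Phi j) v *: Phi j = c *: v.
  apply: form_inj => x; rewrite form_lincombr formZr -cE.
  by apply: eq_bigr => j _; rewrite mulrC.
have cS l : \sum_j vcoord (Phi j) l * form (Phi j) (e l) = c.
  have /(congr1 (fun v => vcoord v l)) := opE (e l).
  rewrite /vcoord linear_sum linearZ /= coord_free ?eqxx ?mulr1.
    by move=> <-; apply: eq_bigr => j _; rewrite linearZ mulrC.
  exact: basis_free (vbasisP _).
transitivity (\sum_(l < d) \sum_j vcoord (Phi j) l * form (Phi j) (e l)).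
  by rewrite (eq_bigr (fun=> c)) ?sumr_const ?card_ord ?mulr_natl // => l _; exact: cS.
rewrite exchange_big /= mulr_natl -[X in _ *+ X]card_ord -sumr_const.
apply: eq_bigr => j _; rewrite -(eqs_norm Phi_eqs j).
by rewrite -form_lincombr -vcoordE.
Qed.

(** This case occurs: in characteristic 2, the vectors e, f, e + f of a symplectic plane with <e, f>
    = 1 have a = 0 and b = c = 1. *)
Lemma equiangular_system_isotropic c :
    (forall x v, \sum_j form x (Phi j) * form (Phi j) v = c * form x v) ->
  c != 0 -> a = 0 -> [/\ 2%N \in [pchar F], sigma =1 id & d = 2%N].
Proof.
move=> cE c0 a0.
have b0 : b != 0 by move: neq_a2b; rewrite a0 expr0n /= eq_sym.
have dz : d%:R = 0 :> F.
  apply: (mulIf c0).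
  by rewrite (tight_constant_trace cE) a0 mulr0 mul0r.
(* Tightness at (phi_0, phi_0) reads m b = c a = 0. *)
have mz : m%:R = 0 :> F.
  apply: (mulIf b0); rewrite mul0r.
  have := cE (Phi ord0) (Phi ord0).
  rewrite !(eqs_norm Phi_eqs) a0 mulr0 big_ord_recl !(eqs_norm Phi_eqs) a0 mulr0.
  rewrite add0r => <-.
  rewrite mulr_natl -[X in _ *+ X]card_ord -sumr_const; apply: eq_bigr => j _.
  by rewrite (eqs_angle Phi_eqs).
have nE : m.+1%:R = 1 :> F by rewrite -addn1 natrD mz add0r.
case: kP => [[s1 k1]|[_ k2]]; last first.
  (* Nontrivial [sigma] would give n = d ^ 2 = 0 in F, against n = 1. *)
  have dd : m.+1 = (d * d)%N by rewrite mE k2 gerzon_bound2.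
  by move: nE (oner_neq0 F); rewrite dd natrM dz mul0r => <-; rewrite eqxx.
have dd : (2 * m.+1 = d * d.+1)%N by rewrite mE k1 gerzon_bound1.
have two0 : 2%:R = 0 :> F.
  by move: (congr1 (fun i => i%:R : F) dd); rewrite !natrM nE dz mulr1 mul0r.
have ch2 : 2%N \in [pchar F] by rewrite inE /= two0 eqxx.
split=> //.
have d1 : d <> 1%N.
  by move=> d1; move: dz; rewrite d1 => /eqP; rewrite oner_eq0.
have m0 : (0 < m)%N by nia.
pose i1 : 'I_m.+1 := Ordinal (m0 : (1 < m.+1)%N).
pose beta := form (Phi ord0) (Phi i1).
have sqE i j : i != j -> form (Phi i) (Phi j) ^+ 2 = b.
  by move=> /(eqs_angle Phi_eqs) <-; rewrite expr2 [form (Phi j) _](form_herm form_ok) s1.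
(* Squaring is injective in characteristic 2, so the common square b determines the off-diagonal
   value. *)
have betaE i j : i != j -> form (Phi i) (Phi j) = beta.
  move=> ij; apply/eqP; rewrite -subr_eq0 -sqrf_eq0.
  have -> x y : (x - y) ^+ 2 = (x ^+ 2 - y ^+ 2) - 2%:R * (y * (x - y)) :> F by ring.
  by rewrite !sqE // two0 mul0r !subr0 subrr.
have beta0 : 0 != beta.
  by rewrite eq_sym -sqrf_eq0 sqE.
have tauE i j : form (Phi i) (Phi j) = if i == j then 0 else beta.
  by have [->|/betaE//] := eqVneq i j; rewrite (eqs_norm Phi_eqs) a0.
(* The functionals <phi_i, .> take the values 0 and [beta] on the phi_j, so all but one of the
   vectors are free. *)
have := free_tail (fun i => form_linear form_ok (Phi i)) tauE (fun i => form0r (Phi i)) beta0.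
rewrite /free size_tuple => /eqP fE.
(* Now m <= d and 2 (m + 1) = d (d + 1) give (d - 2) (d + 1) <= 0, while d is neither 0 nor 1. *)
have := dimvS (subvf <<tail_family Phi>>); rewrite fE -/d; nia.
Qed.

End EquiangularSystem.

End HermitianForm.

Theorem theorem4p2 (F : fieldType) (sigma : {rmorphism F -> F})
    (sigmaK : involutive sigma) (k : nat) (dim_k : fixed_field_dim sigma k)
    (V : vectType F) (d : nat) (dim_d : \dim {:V} = d)
    (form : V -> V -> F) (form_ok : nondeg_hermitian sigma form)
    (a b : F) (a_fixed : a \in fixed_field sigma)
    (b_fixed : b \in fixed_field sigma) (neq_a2b : a ^+ 2 != b)
    (n : nat) (Phi : 'I_n -> V)
    (Phi_eqs : equiangular_system sigma form a b Phi) :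
  ((0 < d)%N -> (n <= gerzon_bound k d)%N) /\
  (n = gerzon_bound k d ->
   exists c : F,
     [/\ c \in fixed_field sigma,
         forall v, frame_operator form Phi v = c *: v,
         ~ [/\ 2%N \in [pchar F], sigma =1 id & d = 2%N] -> a = 0 -> c = 0
       & ~ (d = 1%N /\ a = 0) ->
         case_O sigma \/ case_U sigma ->
         equiangular_tight_frame sigma form a b c Phi]).
Proof.
have kP := (fixed_field_dimP k sigmaK).1 dim_k.
subst d; split.
  by move=> d0; case: n Phi Phi_eqs => // m Phi /equiangular_system_bound; exact.
(* In dimension 0 every vector is 0, and c = 0 works. *)
have [d0|d_gt0] := posnP (\dim {:V}).
  have V0 (v : V) : v = 0.
    by apply/eqP; rewrite -memv0 -(eqP (_ : fullv == 0%VS)) ?memvf // -dimv_eq0 d0.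
  move=> _; exists 0; have f0 : 0 \in fixed_field sigma by rewrite inE rmorph0.
  have op0 v : frame_operator form Phi v = 0 *: v by rewrite (V0 (_ *: _)); exact: V0.
  split=> // _ _; split=> //.
  by apply/vspaceP => v; rewrite (V0 v) !mem0v.
case: n Phi Phi_eqs => [|m] Phi Phi_eqs nE; first by move: nE; rewrite /gerzon_bound; lia.
have [c cE] := equiangular_system_tight form_ok kP neq_a2b Phi_eqs d_gt0 nE.
(* Applying [sigma] to the tightness identity at (v, x) gives the one at (x, v) with [sigma c] for
   c. *)
have c_fixed : c \in fixed_field sigma.
  have [x [v xv]] := form_neq0_dual form_ok d_gt0.
  rewrite inE; apply/eqP/(mulIf xv).
  have := congr1 sigma (cE v x); rewrite rmorphM -(form_herm form_ok) => <-.
  rewrite -cE rmorph_sum; apply: eq_bigr => j _.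
  by rewrite rmorphM -!(form_herm form_ok) mulrC.
have tight v : frame_operator form Phi v = c *: v.
  apply: (form_inj form_ok) => x.
  rewrite (form_lincombr form_ok) (formZr form_ok) -cE.
  by apply: eq_bigr => j _; rewrite mulrC.
exists c; split=> //.
  move=> not2 a0; have [//|c0] := eqVneq c 0; case: not2.
  exact: (equiangular_system_isotropic form_ok kP neq_a2b Phi_eqs
           d_gt0 nE cE c0 a0).
move=> nd _; split=> //.
exact: (equiangular_system_span form_ok kP neq_a2b Phi_eqs d_gt0 nE nd).
Qed.
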